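(* Let $X$ be a path connected compact metrizable space and $Y$ a compact metrizable space. Let $p,q$ be distinct points of $X$, let $z,w$ be points of $Y$, and let $\alpha\in(0,1)$. For any finite subset $F\subset C(X)_{(p,q,\alpha)}$ and any $\epsilon>0$, there is an integer $N>0$ with the following property: for any unital positive linear map $\phi:C(X)\to C(Y)$ which sends $C(X)_{(p,q,\alpha)}$ into $C(Y)_{(z,w,\alpha)}$, there are $N$ homomorphisms $\phi_1,\phi_2,\dots,\phi_N:C(X)\to C(Y)$ such that $\frac1N\sum_{i=1}^N\phi_i(f)\in C(Y)_{(z,w,\alpha)}$ for all $f\in C(X)_{(p,q,\alpha)}$, and $$\Big\|\phi(f)-\frac1N\sum_{i=1}^N\phi_i(f)\Big\|<\epsilon\quad\text{for all } f\in F.$$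
   Context: For a compact metrizable space $X$, $C(X)$ is the C*-algebra of continuous functions on $X$ with the supremum norm. For points $p,q\in X$, $z,w\in Y$ and $\alpha\in(0,1)$, $$C(X)_{(p,q,\alpha)}=\{f\in C(X)\mid f(p)=\alpha f(q)\},\qquad C(Y)_{(z,w,\alpha)}=\{f\in C(Y)\mid f(z)=\alpha f(w)\}.$$ Homomorphism means $*$-homomorphism. A linear map is positive if it sends nonnegative functions to nonnegative functions, and unital if it sends the constant function $1$ to $1$. *)

(* Defs.v *)
From HB Require Import structures.
From mathcomp Require Import all_boot all_order all_algebra.
From mathcomp Require Import all_classical all_reals all_analysis.
From mathcomp Require Export complex.

Set Implicit Arguments.
Unset Strict Implicit.
Unset Printing Implicit Defensive.

Import Order.TTheory GRing.Theory Num.Theory.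
Import numFieldNormedType.Exports.

Local Open Scope classical_set_scope.
Local Open Scope ring_scope.
Local Open Scope complex_scope.

Definition homeomorphic (X Y : topologicalType) : Prop :=
  exists (f : X -> Y) (g : Y -> X),
    [/\ continuous f, continuous g, cancel f g & cancel g f].

Definition metrizable (R : realType) (X : topologicalType) : Prop :=
  exists M : metricType R, homeomorphic X M.

Definition path_connected (R : realType) (X : topologicalType) : Prop :=
  forall x y : X, exists g : R -> X,
    [/\ {within `[0, 1], continuous g}, g 0 = x & g 1 = y].

(* The scalars are written [R[i]^o], not [R[i]], because the library puts the
   norm topology of the field [R[i]] on the alias [R[i]^o]. *)
Definition contfun (R : realType) (X : topologicalType) : Type :=
  continuousType X (R[i]^o).

Notation "''C' [ R ] ( X )" := (contfun R X)
  (at level 8, format "''C' [ R ] ( X )") : type_scope.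

Section Algebra.
Variables (R : realType) (X : topologicalType).

HB.instance Definition _ := Choice.copy 'C[R](X) (continuousType X (R[i]^o)).

Implicit Types f g h : 'C[R](X).

Definition eval f : X -> R[i]^o := f.

Lemma contfunP f g : eval f =1 eval g -> f = g.
Proof. by move=> fg; apply/continuousEP. Qed.

Lemma cst_cont (c : R[i]^o) : continuous (fun _ : X => c).
Proof. by move=> x; exact: cvg_cst. Qed.

Lemma add_cont f g : continuous (fun x => eval f x + eval g x).
Proof. by move=> x; apply: cvgD; exact: cts_fun. Qed.

Lemma opp_cont f : continuous (fun x => - eval f x).
Proof. by move=> x; apply: cvgN; exact: cts_fun. Qed.

Lemma mul_cont f g : continuous (fun x => eval f x * eval g x).
Proof. by move=> x; apply: cvgM; exact: cts_fun. Qed.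

Lemma scale_cont (c : R[i]) f : continuous (fun x => (c : R[i]^o) * eval f x).
Proof. by move=> x; apply: cvgM; [exact: cvg_cst|exact: cts_fun]. Qed.

Lemma star_cont f : continuous (fun x => Num.conj (eval f x) : R[i]^o).
Proof.
move=> x; apply/cvgrPdist_lt => e e0.
have /cvgrPdist_lt/(_ _ e0) := @cts_fun _ _ f x.
by apply: filterS => y; rewrite -rmorphB norm_conjC.
Qed.

Definition cf_zero : 'C[R](X) := mkcts (@cst_cont 0).
Definition cf_one : 'C[R](X) := mkcts (@cst_cont 1).
Definition cf_add f g : 'C[R](X) := mkcts (@add_cont f g).
Definition cf_opp f : 'C[R](X) := mkcts (@opp_cont f).
Definition cf_mul f g : 'C[R](X) := mkcts (@mul_cont f g).
Definition cf_scale (c : R[i]) f : 'C[R](X) := mkcts (@scale_cont c f).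
Definition cf_star f : 'C[R](X) := mkcts (@star_cont f).

Fact cf_addA : associative cf_add.
Proof. by move=> f g h; apply: contfunP => x; exact: addrA. Qed.
Fact cf_addC : commutative cf_add.
Proof. by move=> f g; apply: contfunP => x; exact: addrC. Qed.
Fact cf_add0 : left_id cf_zero cf_add.
Proof. by move=> f; apply: contfunP => x; exact: add0r. Qed.
Fact cf_addN : left_inverse cf_zero cf_opp cf_add.
Proof. by move=> f; apply: contfunP => x; exact: addNr. Qed.

HB.instance Definition _ :=
  GRing.isZmodule.Build 'C[R](X) cf_addA cf_addC cf_add0 cf_addN.

Fact cf_mulA : associative cf_mul.
Proof. by move=> f g h; apply: contfunP => x; exact: mulrA. Qed.
Fact cf_mulC : commutative cf_mul.
Proof. by move=> f g; apply: contfunP => x; exact: mulrC. Qed.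
Fact cf_mul1 : left_id cf_one cf_mul.
Proof. by move=> f; apply: contfunP => x; exact: mul1r. Qed.
Fact cf_mulD : left_distributive cf_mul cf_add.
Proof. by move=> f g h; apply: contfunP => x; exact: mulrDl. Qed.

HB.instance Definition _ :=
  GRing.Zmodule_isComPzRing.Build 'C[R](X) cf_mulA cf_mulC cf_mul1 cf_mulD.

Fact cf_scaleA a b f : cf_scale a (cf_scale b f) = cf_scale (a * b) f.
Proof. by apply: contfunP => x; exact: mulrA. Qed.
Fact cf_scale1 : left_id 1 cf_scale.
Proof. by move=> f; apply: contfunP => x; exact: mul1r. Qed.
Fact cf_scaleDr : right_distributive cf_scale +%R.
Proof. by move=> a f g; apply: contfunP => x; exact: mulrDr. Qed.
Fact cf_scaleDl f : {morph cf_scale^~ f : a b / a + b}.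
Proof. by move=> a b; apply: contfunP => x; exact: mulrDl. Qed.

HB.instance Definition _ := GRing.Zmodule_isLmodule.Build R[i] 'C[R](X)
  cf_scaleA cf_scale1 cf_scaleDr cf_scaleDl.

(* The norm is real-valued: [`|f x|] is the modulus seen in [R[i]].
   The supremum is the intended one when [X] is compact. *)
Definition supnorm f : R := sup (range (fun x => complex.Re `|f x|)).

Definition nonneg f : Prop := forall x, 0 <= f x.

Definition twisted (p q : X) (alpha : R) : set 'C[R](X) :=
  [set f | f p = alpha%:C * f q].

End Algebra.

Arguments twisted {R X}.

Section Maps.
Variables (R : realType) (X Y : topologicalType).
Implicit Type phi : {linear 'C[R](X) -> 'C[R](Y)}.

Definition positive phi : Prop := forall f, nonneg f -> nonneg (phi f).

Definition unital phi : Prop := phi 1 = 1.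

(* As usual for *-homomorphisms, preservation of the unit is not required. *)
Definition star_hom phi : Prop :=
  {morph phi : f g / f * g} /\ {morph phi : f / cf_star f}.

End Maps.

(* Main.v *)
Require Import Defs.
From HB Require Import structures.
From mathcomp Require Import all_boot all_order all_algebra.
From mathcomp Require Import all_classical all_reals all_analysis.
From mathcomp Require Import complex.
From mathcomp Require Import ring lra.

Set Implicit Arguments.
Unset Strict Implicit.
Unset Printing Implicit Defensive.

Import Order.TTheory GRing.Theory Num.Theory.
Import numFieldNormedType.Exports.

Local Open Scope classical_set_scope.
Local Open Scope ring_scope.

(** Why the theorem is true.

    The functionals [f |-> phi f z] and [f |-> phi f w] are probability measures
    [mu] and [nu] on [X], and the hypothesis says that [mu - alpha nu] vanishes
    on the kernel of [delta_p - alpha delta_q].  It is therefore a multiple of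
    [delta_p - alpha delta_q], and evaluation at [1] shows that the factor is
    [1] ([twisted_defect]).  Positivity at [q] then forces [nu = delta_q],
    whence [mu = delta_p].  So the twisted condition is an interpolation
    condition: it is enough to approximate [phi] by averages of composition
    operators [f |-> f \o h_i] with [h_i z = p] and [h_i w = q].

    Choose a partition of unity [rho_0, ..., rho_n] on [X] with base points
    [pt 0 = p, ..., pt n = q], so fine that every [f] in [F] is almost constant
    on each support, and with [rho_0 p = rho_n q = 1] ([pinned_partition]).  By
    positivity [phi f] is uniformly close to [sum_k l_k * f (pt k)], where the
    weights [l_k = phi rho_k] are nonnegative, continuous on [Y], and of sum [1]
    ([phi_quantize]).  By the previous paragraph [l_0 z = 1] and [l_n w = 1].

    It remains to turn the measure [sum_k l_k(y) delta_(pt k)] into a uniform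
    measure on [N] points which move continuously with [y].  Join the base
    points by a path [g] with [g k = pt k].  The [N]-quantiles of the measure on
    the integers [0, ..., n] with weights [l_k(y)] jump with [y]; smoothing them
    on the scale [1/N] gives continuous real numbers [T_i(y)], and
    [h_i = g \o T_i].  All but at most [n] of the [T_i(y)] are integers, so the
    average of the [f (h_i y)] differs from [sum_k l_k(y) f (pt k)] by at most
    [2 n |f| / N] ([average_staircase]).  This bound, hence [N], depends on the
    partition and on a bound for [F], but not on [phi].  Where [l_0 = 1] all the
    [T_i] are [0], and where [l_n = 1] they are all [n]; so the interpolation
    conditions hold exactly. *)

(** * Smoothed quantiles of a measure on an initial segment of the integers *)

Section Staircase.
Variable R : realFieldType.
Implicit Types (c l : nat -> R) (G : R -> R) (a s t M : R).

Definition clamp t : R := Num.max 0 (Num.min t 1).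

Lemma clamp_ge0 t : 0 <= clamp t.
Proof. by rewrite le_max lexx. Qed.

Lemma clamp_le1 t : clamp t <= 1.
Proof. by rewrite ge_max ler01 ge_min lexx orbT. Qed.

Lemma clamp_eq0 t : t <= 0 -> clamp t = 0.
Proof. by move=> t0; rewrite /clamp max_l// ge_min t0. Qed.

Lemma clamp_eq1 t : 1 <= t -> clamp t = 1.
Proof. by move=> t1; rewrite /clamp min_r// max_r. Qed.

Lemma le_clamp s t : s <= t -> clamp s <= clamp t.
Proof. by move=> st; rewrite ge_max clamp_ge0 le_max le_min !ge_min st lexx !orbT. Qed.

Lemma clampE t : clamp t = Num.max 0 t - Num.max 0 (t - 1).
Proof.
by rewrite /clamp; case: (leP t 1); case: (leP 0 t); case: (leP 0 (t - 1));
  rewrite ?(max_r ler01); lra.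
Qed.

(** By [clampE] the sum telescopes, so it is exact: smoothing the quantiles
    introduces no error in their total mass. *)
Lemma sum_clamp N a : 0 <= a <= N%:R ->
  \sum_(i < N) clamp (i.+1%:R - a) = N%:R - a.
Proof.
move=> /andP[a0 aN].
rewrite (eq_bigr (fun i : 'I_N =>
   Num.max 0 (i.+1%:R - a) - Num.max 0 (i%:R - a))); last first.
  by move=> i _; rewrite clampE; congr (_ - Num.max 0 _); rewrite -natr1; ring.
rewrite -(big_mkord xpredT (fun i =>
  Num.max 0 (i.+1%:R - a) - Num.max 0 (i%:R - a))) telescope_sumr//.
by rewrite (max_r (y := N%:R - a)) ?max_l; lra.
Qed.

(** A level is fractional only when its threshold lies strictly between two
    consecutive integers; each threshold spoils at most one index. *)
Lemma sum_gap_le1 N t : \sum_(i < N) (i%:R < t < i.+1%:R)%R%:R <= 1 :> R.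
Proof.
suff: \sum_(i < N) (i%:R < t < i.+1%:R)%R%:R <= (t < N%:R)%R%:R :> R.
  by move/le_trans; apply; case: (_ < _).
elim: N => [|N IH]; first by rewrite big_ord0.
rewrite big_ord_recr/=; have [/andP[Nt tN]|_] := boolP (_ < t < _).
  by rewrite tN; move: IH; rewrite ltNge (ltW Nt)/= => ?; lra.
rewrite addr0; apply: (le_trans IH); rewrite ler_nat.
by case: (ltP t) => //= tN; rewrite (lt_trans tN)// ltr_nat.
Qed.

(** The integral of [G] against the measure on [0, ..., n] whose upper tails are
    [c 0 = 1 >= c 1 >= ... >= c n]. *)
Definition staircase c n G : R :=
  \sum_(j < n) (c j - c j.+1) * G j%:R + c n * G n%:R.

(** Tails with values in [{0, 1}] are those of a Dirac mass, which sits at the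
    number of nonzero tails after [c 0]. *)
Lemma staircase_integral c n G :
  c 0%N = 1 -> (forall k, c k.+1 <= c k) ->
  (forall k, (k < n)%N -> c k.+1 = 0 \/ c k.+1 = 1) ->
  staircase c n G = G (\sum_(k < n) c k.+1).
Proof.
move=> c0 cS; rewrite /staircase; elim: n => [|n IH] c01.
  by rewrite !big_ord0 c0 add0r mul1r.
have {}IH := IH (fun k kn => c01 k (ltnW kn)).
rewrite !big_ord_recr/=; case: (c01 n (leqnn _)) => cn.
  by rewrite cn mul0r addr0 subr0 addr0.
(* The tail at [n.+1] is [1], hence so are all the earlier ones. *)
have c1 k : (k <= n.+1)%N -> c k = 1.
  elim: k => [//|k IHk] kn; case: (c01 k kn) => // ck0.
  have : c n.+1 <= c k.+1.
    by rewrite -(subnKC kn); elim: (_ - _)%N => [|d IHd];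
      rewrite ?addn0// addnS (le_trans (cS _)).
  by rewrite cn ck0; lra.
rewrite (c1 n (leqnSn _)) cn subrr mul0r addr0 mul1r.
rewrite big1 ?add0r; last first.
  move=> j _; rewrite !c1 ?subrr ?mul0r//; first by rewrite (leq_trans _ (leqnSn _)).
  by rewrite leqW // ltnW.
rewrite (eq_bigr (fun=> 1)) => [|i _]; last by rewrite c1 // leqW.
by rewrite sumr_const card_ord natr1.
Qed.

Lemma staircase_bound c n G M :
  c 0%N = 1 -> (forall k, c k.+1 <= c k) -> 0 <= c n ->
  (forall t, `|G t| <= M) -> `|staircase c n G| <= M.
Proof.
move=> c0 cS cn GM.
have -> : M = staircase c n (fun=> M).
  rewrite /staircase -mulr_suml -mulrDl.
  rewrite -(big_mkord xpredT (fun j => c j - c j.+1)).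
  rewrite (eq_bigr (fun j => - (c j.+1 - c j))) => [|j _]; last by rewrite opprB.
  by rewrite sumrN telescope_sumr// c0 opprB subrK mul1r.
apply: (le_trans (ler_normD _ _)); apply: lerD; last first.
  by rewrite normrM (ger0_norm cn) ler_wpM2l.
apply: (le_trans (ler_norm_sum _ _ _)); apply: ler_sum => j _.
by rewrite normrM ger0_norm ?subr_ge0// ler_wpM2l ?subr_ge0.
Qed.

(** The sum counts the fractional tails: without any the two values agree, and
    otherwise the trivial bound [2 * M] is affordable. *)
Lemma staircase_approx c n G M :
  c 0%N = 1 -> (forall k, c k.+1 <= c k) -> (forall k, 0 <= c k) ->
  (forall t, `|G t| <= M) ->
  `|staircase c n G - G (\sum_(k < n) c k.+1)| <=
    2 * M * \sum_(k < n) (0 < c k.+1 < 1)%R%:R.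
Proof.
move=> c0 cS cge0 GM; have M0 : 0 <= M by apply: le_trans (GM 0).
have cle1 k : c k <= 1 by elim: k => [|k /(le_trans (cS k))]; rewrite ?c0.
have [/forallP allint|] := boolP [forall k : 'I_n, ~~ (0 < c k.+1 < 1)].
  rewrite staircase_integral// ?subrr ?normr0.
    by rewrite mulr_ge0 ?mulr_ge0// sumr_ge0.
  move=> k kn; have := allint (Ordinal kn); rewrite negb_and -!leNgt/=.
  by case/orP => h; [left|right]; apply/eqP; rewrite eq_le ?cge0 ?cle1 ?h.
rewrite negb_forall => /existsP[k /negPn ck].
apply: (@le_trans _ _ (2 * M)).
  by rewrite mulr2n mulrDl mul1r (le_trans (ler_normB _ _))// lerD// staircase_bound.
by rewrite ler_peMr ?mulr_ge0// (bigD1 k)//= ck lerDl sumr_ge0.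
Qed.

(** For a fixed [i] these are the upper tails, in [k], of the share of the
    measure [l] carried by the quantile slot between [i / N] and [i.+1 / N];
    the threshold [N * (l 0 + ... + l k.-1)] is compared with [i.+1] through
    [clamp], which keeps the value continuous in [l]. *)
Definition level l N i k : R := clamp (i.+1%:R - N%:R * \sum_(j < k) l j).

(** The slots add up exactly to the measure [l] ([sum_clamp]), and only the at
    most [n] slots met by a threshold contribute an error ([sum_gap_le1]). *)
Theorem average_staircase l n N G M :
  (forall k, 0 <= l k) -> \sum_(j < n.+1) l j = 1 -> (0 < N)%N ->
  (forall t, `|G t| <= M) ->
  `|\sum_(j < n.+1) l j * G j%:R
     - N%:R^-1 * \sum_(i < N) G (\sum_(k < n) level l N i k.+1)|
  <= 2 * M * n%:R / N%:R.
Proof.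
move=> l0 l1 N0 GM; have M0 : 0 <= M by apply: le_trans (GM 0).
have NR : 0 < N%:R :> R by rewrite ltr0n.
have lmono k m : (k <= m)%N -> \sum_(j < k) l j <= \sum_(j < m) l j.
  move=> /subnKC <-; elim: (_ - _)%N => [|d IH]; first by rewrite addn0.
  by rewrite addnS big_ord_recr/= (le_trans IH)// lerDl.
have level0 i : level l N i 0 = 1.
  by rewrite /level big_ord0 mulr0 subr0 clamp_eq1// ler1n.
have sum_level k : (k <= n.+1)%N ->
    \sum_(i < N) level l N i k = N%:R * (1 - \sum_(j < k) l j).
  move=> kn; rewrite sum_clamp ?mulrBr ?mulr1// mulr_ge0 ?sumr_ge0//=.
  by rewrite -[leRHS]mulr1 ler_pM2l// -l1 lmono.
have -> : \sum_(j < n.+1) l j * G j%:R =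
    N%:R^-1 * \sum_(i < N) staircase (level l N i) n G.
  rewrite big_split/= -mulr_suml sum_level// exchange_big/= mulrDr.
  rewrite mulrA mulKf ?gt_eqF// big_ord_recr/=; congr (_ + _ * _); last first.
    by apply/eqP; rewrite eq_sym subr_eq addrC -l1 big_ord_recr.
  rewrite mulr_sumr; apply: eq_bigr => j _.
  rewrite -mulr_suml sumrB !sum_level ?leqW// ?big_ord_recr/=; last exact: ltnW.
  by field; rewrite gt_eqF.
rewrite -mulrBr -sumrB normrM ger0_norm ?invr_ge0 ?(ltW NR)// mulrC.
rewrite ler_pM2r ?invr_gt0//; apply: (le_trans (ler_norm_sum _ _ _)).
apply: (@le_trans _ _ (\sum_(i < N)
    2 * M * \sum_(k < n) (0 < level l N i k.+1 < 1)%R%:R)).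
  apply: ler_sum => i _; apply: staircase_approx => //.
  - by move=> k; apply: le_clamp; rewrite lerD2l lerN2 ler_pM2l// lmono.
  - by move=> k; exact: clamp_ge0.
rewrite -mulr_sumr ler_wpM2l ?mulr_ge0// exchange_big/=.
apply: (@le_trans _ _ (\sum_(k < n) 1)); last by rewrite sumr_const card_ord.
apply: ler_sum => k _.
apply: le_trans (sum_gap_le1 N (N%:R * \sum_(j < k.+1) l j)).
apply: ler_sum => i _; rewrite ler_nat /level.
have [h|//] := boolP (0 < clamp _ < 1).
case/andP: h => h0 h1; set t := N%:R * _ in h0 h1 *.
have -> : i%:R < t.
  by rewrite ltNge; apply/negP => ti; rewrite clamp_eq1 ?ltxx in h1; move=> //;
     rewrite -natr1; lra.
suff -> : t < i.+1%:R by [].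
by rewrite ltNge; apply/negP => ti; rewrite clamp_eq0 ?ltxx in h0; move=> //; lra.
Qed.

End Staircase.

(** * Paths and partitions of unity in a compact space *)

Section Topology.
Variables (R : realType) (X : topologicalType).

Lemma continuous_sum (I : Type) (r : seq I) (F : I -> X -> R) :
  (forall i, continuous (F i)) -> continuous (fun x => \sum_(i <- r) F i x).
Proof.
move=> cF; apply: (@continuous_big R I +%R 0 xpredT) => [|i _]; last exact: cF.
exact: (@pseudometric_normed_Zmodule.add_continuous _ R).
Qed.

Lemma continuous_clamp : continuous (@clamp R).
Proof.
move=> t; apply: (@continuous_max R R (cst 0) (fun s => Num.min s 1)).
  exact: cvg_cst.
by apply: (@continuous_min R R idfun (cst 1)); [exact: cvg_id|exact: cvg_cst].
Qed.

(** Reparametrising each connecting path by [clamp] makes it defined on the whole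
    line and constant outside its unit interval, so that the pieces can be glued
    along the closed half-lines on both sides of an integer. *)
Lemma chain_path (pt : nat -> X) n : path_connected R X ->
  exists2 g : R -> X, continuous g &
    forall k, (k <= n)%N -> g k%:R = pt k.
Proof.
move=> Xpath; elim: n => [|n [g cg gpt]].
  exists (fun=> pt 0%N) => [x|k]; first exact: cvg_cst.
  by rewrite leqn0 => /eqP ->.
have [h [ch h0 h1]] := Xpath (pt n) (pt n.+1).
pose hc t := h (clamp (t - n%:R)).
have chc : continuous hc.
  have -> : hc = (h \o @clamp R) \o (fun t => t - n%:R) by [].
  move=> t; apply: continuous_comp.
    by apply: cvgB; [exact: cvg_id|exact: cvg_cst].
  set s := t - n%:R; move=> U.
  have /subspace_continuousP/(_ (clamp s)) := ch.
  rewrite /= in_itv/= clamp_ge0 clamp_le1 => /(_ isT) /[apply].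
  rewrite !nbhs_simpl/= => /continuous_clamp.
  apply: (@filterS _ (nbhs s)) => v /= Uv.
  by apply: Uv; rewrite in_itv/= clamp_ge0 clamp_le1.
exists (fun t => if t <= n%:R then g t else hc t); last first.
  move=> k; rewrite leq_eqVlt ltnS => /predU1P[->|kn].
    rewrite ler_nat ltnn /hc -natr1 addrAC subrr add0r clamp_eq1//.
  by rewrite ler_nat kn gpt.
apply/continuous_subspace_setT.
have -> : [set: R] = `]-oo, n%:R] `|` `[n%:R, +oo[.
  by apply/seteqP; split=> // t _; rewrite /= !in_itv/= andbT; apply/orP/le_total.
apply: withinU_continuous; [exact: interval_closed|exact: interval_closed| |].
  apply: (@subspace_eq_continuous _ _ _ g); last exact: continuous_subspaceT.
  by move=> t; rewrite inE/= in_itv/= => tn; rewrite /from_subspace tn.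
apply: (@subspace_eq_continuous _ _ _ hc); last exact: continuous_subspaceT.
move=> t; rewrite inE/= in_itv/= andbT /from_subspace => nt.
case: ifPn => // tn; have -> : t = n%:R by apply/eqP; rewrite eq_le tn.
by rewrite /hc subrr clamp_eq0// h0 gpt.
Qed.

Lemma finite_net (D : X -> X -> R) (delta : R) : X ->
  compact [set: X] -> (forall x, D x x < delta) ->
  (forall a, continuous (D^~ a)) ->
  exists s : seq X, forall x, exists2 a, a \in s & D x a < delta.
Proof.
move=> x0 Xc Dd cD.
pose X' : ptopologicalType := HB.pack X (isPointed.Build X x0).
have : @cover_compact X' setT by rewrite -(compact_cover X'); exact: Xc.
case/(_ X' setT (fun a => [set x | D x a < delta])).
- move=> a _; apply: (@open_comp X' R (D^~ a) [set t | t < delta]).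
    by move=> x _; exact: cD.
  exact: open_lt.
- by move=> x _; exists x => //=; exact: Dd.
by move=> s _ sX; exists (finmap.enum_fset s) => x; have [a] := sX x I; exists a.
Qed.

(** A partition of unity made of bumps of radius [delta] around the points of a
    finite net to which [p] and [q] are added.  Multiplying all the bumps but the
    first by the distance to [p], and all but the last by the distance to [q],
    leaves only one nonzero bump at [p] and only one at [q]. *)
Lemma pinned_partition (D : X -> X -> R) (delta : R) (p q : X) :
  compact [set: X] -> (forall x y, 0 <= D x y) -> (forall x, D x x = 0) ->
  (forall x y, D x y = 0 -> x = y) -> (forall a, continuous (D^~ a)) ->
  p <> q -> 0 < delta ->
  exists n (pt : nat -> X) (rho : nat -> X -> R),
    [/\ pt 0%N = p /\ pt n = q,
        [/\ rho 0%N p = 1, rho 0%N q = 0, rho n p = 0 & rho n q = 1],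
        forall k, continuous (rho k),
        (forall k x, 0 <= rho k x) /\ (forall x, \sum_(k < n.+1) rho k x = 1) &
        forall k x, rho k x != 0 -> D x (pt k) < delta].
Proof.
move=> Xc D0 Dxx Deq cD pq delta0.
have Dpos x y : x <> y -> 0 < D x y.
  by move=> xy; rewrite lt_neqAle D0 andbT eq_sym; apply/eqP => /Deq.
have [|s snet] := finite_net p Xc _ cD (delta := delta).
  by move=> x; rewrite Dxx.
pose n := (size s).+1; pose pt := nth q (p :: s).
have ptn : pt n = q by rewrite /pt/= nth_default.
pose bump k x := Num.max 0 (delta - D x (pt k)).
pose cut (b : bool) a x := if b then 1 else D x a.
pose tau k x := cut (k == 0%N) p x * cut (k == n) q x * bump k x.
have cut0 b a x : 0 <= cut b a x by rewrite /cut; case: ifP.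
have bump0 k x : 0 <= bump k x by rewrite le_max lexx.
have tau0 k x : 0 <= tau k x by rewrite !mulr_ge0.
have bump_gt0 k x : D x (pt k) < delta -> 0 < bump k x.
  by move=> h; rewrite lt_max subr_gt0 h orbT.
have ctau k : continuous (tau k).
  have ccut b a : continuous (cut b a) by rewrite /cut; case: b => // ?; exact: cvg_cst.
  move=> x; rewrite /tau; apply: cvgM; first by apply: cvgM; exact: ccut.
  apply: (@continuous_max R X (cst 0)); first exact: cvg_cst.
  by apply: cvgB; [exact: cvg_cst|exact: cD].
pose S x := \sum_(k < n.+1) tau k x.
have cS : continuous S by exact: continuous_sum.
have S_gt0 x : 0 < S x.
  suff [k kn tk] : exists2 k, (k < n.+1)%N & 0 < tau k x.
    by rewrite /S (bigD1 (Ordinal kn))//= ltr_pwDl// sumr_ge0.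
  have [->|xp] := pselect (x = p).
    exists 0%N => //; rewrite /tau/= mul1r mulr_gt0 ?Dpos//.
    by rewrite bump_gt0// Dxx.
  have [->|xq] := pselect (x = q).
    exists n => //; rewrite /tau/= eqxx mulr1 mulr_gt0 ?Dpos//.
      by move/esym.
    by rewrite bump_gt0// ptn Dxx.
  have [a sa Da] := snet x; exists (index a s).+1.
    by rewrite !ltnS ltnW// index_mem.
  rewrite !mulr_gt0//; first exact: Dpos.
    by rewrite /cut; case: ifP => // _; exact: Dpos.
  by rewrite bump_gt0// /pt/= nth_index.
exists n, pt, (fun k x => tau k x / S x); split.
- by [].
- have one k x : tau k x = S x -> tau k x / S x = 1.
    by move=> ->; rewrite divff// gt_eqF.
  split; last first.
  + apply: one; rewrite /S (bigD1 ord_max)//= big1 ?addr0// => i i0.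
    by rewrite /tau /cut -val_eqE/= in i0 *; rewrite (negbTE i0) Dxx mulr0 mul0r.
  + by rewrite /tau/= Dxx !mul0r.
  + by rewrite /tau/= Dxx mulr0 !mul0r.
  + apply: one; rewrite /S (bigD1 ord0)//= big1 ?addr0// => i i0.
    by rewrite /tau /cut -val_eqE/= in i0 *; rewrite (negbTE i0) Dxx !mul0r.
- move=> k x; apply: cvgM; first exact: ctau.
  by apply: cvgV; [rewrite gt_eqF|exact: cS].
- split=> [k x|x]; first by rewrite divr_ge0// ltW.
  by rewrite -mulr_suml -/(S x) divff// gt_eqF.
- move=> k x rho0; rewrite ltNge; apply: contra rho0 => h.
  by rewrite /tau /bump max_l ?mulr0 ?mul0r ?eqxx// subr_le0.
Qed.

End Topology.

(** * Maps along a path with prescribed average *)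

Section MapsAlongPath.
Variables (R : realType) (X Y : topologicalType).

(** The maps are [g \o T i], where [g] runs through the base points and [T i] is
    the [i]-th smoothed quantile of the weights.  At [z] all thresholds equal [N]
    and no level is reached, so [T i z = 0]; at [w] they all vanish and
    [T i w = n]. *)
Theorem maps_along_path n (pt : nat -> X) (l : nat -> Y -> R) (z w : Y) N :
  path_connected R X -> (0 < N)%N ->
  (forall k, continuous (l k)) -> (forall k y, 0 <= l k y) ->
  (forall y, \sum_(k < n.+1) l k y = 1) -> l 0%N z = 1 -> l n w = 1 ->
  exists h : 'I_N -> Y -> X,
    [/\ forall i, continuous (h i),
        forall i, h i z = pt 0%N /\ h i w = pt n &
        forall (u : X -> R) M, (forall x, `|u x| <= M) -> forall y,
          `|\sum_(k < n.+1) l k y * u (pt k) - N%:R^-1 * \sum_(i < N) u (h i y)|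
            <= 2 * M * n%:R / N%:R].
Proof.
move=> Xpath N0 cl l0 l1 lz lw; have [g cg gpt] := chain_path pt n Xpath.
have NR : 1 <= N%:R :> R by rewrite ler1n.
pose T (i : 'I_N) y := \sum_(k < n) level (l^~ y) N i k.+1.
have iN (i : 'I_N) : i.+1%:R <= N%:R :> R by rewrite ler_nat.
exists (fun i y => g (T i y)); split.
- move=> i y; apply: (@continuous_comp _ _ _ (T i) g); last exact: cg.
  apply: continuous_sum => k {}y.
  apply: (@continuous_comp _ _ _
    (fun y => i.+1%:R - N%:R * \sum_(j < k.+1) l j y));
    last exact: continuous_clamp.
  apply: cvgB; first exact: cvg_cst.
  apply: cvgM; first exact: cvg_cst.
  exact: (@continuous_sum R Y 'I_k.+1 _ (fun j => l j)).
- move=> i; split; rewrite -gpt//; congr g.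
    rewrite [LHS]big1// => k _; rewrite /level clamp_eq0// subr_le0.
    apply: (le_trans (iN i)); rewrite ler_peMr// -lz big_ord_recl lerDl.
    exact: sumr_ge0.
  rewrite /T (eq_bigr (fun=> 1)); first by rewrite sumr_const card_ord.
  move=> k _; rewrite /level big1 ?mulr0 ?subr0 ?clamp_eq1 ?ler1n// => j _.
  have jn : (j < n)%N by apply: leq_trans (ltn_ord j) (ltn_ord k).
  have /eqP : \sum_(j < n) l j w = 0.
    by have := l1 w; rewrite big_ord_recr/= lw; lra.
  rewrite psumr_eq0// => /allP/(_ (Ordinal jn)).
  by rewrite mem_index_enum => /(_ isT)/eqP.
- move=> u M uM y.
  rewrite (eq_bigr (fun k : 'I_n.+1 => l k y * (u \o g) k%:R)); last first.
    by move=> k _; rewrite /= gpt// -ltnS.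
  apply: (@average_staircase R (l^~ y) n N (u \o g) M) => // t.
  exact: uM.
Qed.

End MapsAlongPath.

(** * Complex-valued continuous functions *)

Section ComplexFunctions.
Local Open Scope complex_scope.
Variable R : realType.
Implicit Types (t : R) (c : R[i]).

Lemma normc_real t : `|t%:C| = `|t|%:C.
Proof. by rewrite normc_def/= expr0n addr0 sqrtr_sqr. Qed.

Lemma normi : `|'i%C : R[i]| = 1.
Proof. by rewrite complexiE normCi. Qed.

Lemma Re_norm c : (complex.Re `|c|)%:C = `|c|.
Proof. by rewrite RRe_real// normr_real. Qed.

Lemma Re_mul_real t c : complex.Re (t%:C * c) = t * complex.Re c.
Proof. by case: c => a b /=; rewrite mul0r subr0. Qed.

Lemma ReD c1 c2 : complex.Re (c1 + c2) = complex.Re c1 + complex.Re c2.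
Proof. by case: c1; case: c2. Qed.

Lemma ReB c1 c2 : complex.Re (c1 - c2) = complex.Re c1 - complex.Re c2.
Proof. by case: c1; case: c2. Qed.

Lemma Re_sum (I : Type) (r : seq I) (F : I -> R[i]) :
  complex.Re (\sum_(i <- r) F i) = \sum_(i <- r) complex.Re (F i).
Proof. exact: (big_morph _ ReD). Qed.

Lemma Re_mulB u c1 c2 :
  complex.Re (u * (c1 - c2)) = complex.Re (u * c1) - complex.Re (u * c2).
Proof. by rewrite mulrBr ReB. Qed.

Lemma norm_phase_dist u c1 c2 : `|u| = 1 -> `|u * c1 - u * c2| = `|c1 - c2|.
Proof. by move=> u1; rewrite -mulrBr normrM u1 mul1r. Qed.

Lemma Re_average N u (F : 'I_N -> R[i]) :
  complex.Re (u * (N%:R^-1 * \sum_(i < N) F i)) =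
  N%:R^-1 * \sum_(i < N) complex.Re (u * F i).
Proof. by rewrite mulrCA mulr_sumr -Re_sum -Re_mul_real fmorphV rmorph_nat. Qed.

Lemma normRe_le c : `|complex.Re c| <= complex.Re `|c|.
Proof. by rewrite -lecR Re_norm normc_ge_Re. Qed.

Lemma Re_norm_ge0 c : 0 <= complex.Re `|c|.
Proof. exact: le_trans (normr_ge0 _) (normRe_le c). Qed.

(** Rotating [c] onto the positive axis reduces bounds on complex functions to
    bounds on real parts, with no loss in the constant. *)
Lemma norm_le_phase c t :
  (forall u, `|u| = 1 -> complex.Re (u * c) <= t) -> complex.Re `|c| <= t.
Proof.
move=> H; have [c0|c0] := eqVneq c 0.
  by have := H 1 (normr1 _); rewrite c0 mulr0 normr0.
have := H (`|c| / c); rewrite normrM normr_id normfV mulfV ?normr_eq0//.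
by rewrite divfK// => /(_ erefl).
Qed.

Lemma continuous_RtoC : continuous (fun t => t%:C : R[i]^o).
Proof.
move=> x; apply/cvgrPdist_lt => e; rewrite ltcE/= => /andP[/eqP e0 e1].
have /cvgrPdist_lt/(_ _ e1) := @cvg_id _ (nbhs x).
apply: filterS => y; rewrite -rmorphB/= normc_real.
by rewrite ltcE/= e0 eqxx.
Qed.

Variable X : topologicalType.
Implicit Types f g : 'C[R](X).

Fact realfun_cont (u : X -> R) :
  continuous u -> continuous (fun x => (u x)%:C : R[i]^o).
Proof.
move=> cu x.
by apply: (@continuous_comp _ _ _ u); [exact: cu|exact: continuous_RtoC].
Qed.

Definition realfun (u : X -> R) (cu : continuous u) : 'C[R](X) :=
  mkcts (realfun_cont cu).

Lemma continuous_Re (F : X -> R[i]^o) :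
  continuous F -> continuous (fun x => complex.Re (F x)).
Proof.
move=> cF x; apply/cvgrPdist_lt => e e0.
have /cvgrPdist_lt/(_ e%:C) := cF x; rewrite ltcR => /(_ e0).
apply: filterS => y Fxy; rewrite -ReB -ltcR.
by apply: le_lt_trans Fxy; exact: normc_ge_Re.
Qed.

Lemma continuous_Re_fun f : continuous (fun x => complex.Re (f x)).
Proof. by apply: continuous_Re => x; exact: cts_fun. Qed.

Lemma continuous_dist_fun f a : continuous (fun x => complex.Re `|f x - f a|).
Proof.
apply: (continuous_Re (F := fun x => `|f x - f a|)) => x.
by apply: cvg_norm; apply: cvgB; [exact: cts_fun|exact: cvg_cst].
Qed.

Lemma cf_sumE (I : Type) (r : seq I) (F : I -> 'C[R](X)) x :
  (\sum_(i <- r) F i) x = \sum_(i <- r) F i x.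
Proof. exact: (big_morph (fun f : 'C[R](X) => f x : R[i])). Qed.

(** The real part of [- 'i * f] is the imaginary part of [f]. *)
Lemma cartesian f : f = realfun (@continuous_Re_fun f) +
  'i%C *: realfun (@continuous_Re_fun (- 'i%C *: f)).
Proof.
apply: contfunP => x.
change (f x = (complex.Re (f x))%:C + 'i%C * (complex.Re (- 'i%C * f x))%:C).
by case: (f x) => a b; simpc.
Qed.

End ComplexFunctions.

Section Pullback.
Variables (R : realType) (X Y : topologicalType) (h : Y -> X).
Hypothesis ch : continuous h.

Fact pullback_cont (f : 'C[R](X)) : continuous (fun y => (f : X -> R[i]^o) (h y)).
Proof.
by move=> y; apply: continuous_comp; [exact: ch|exact: cts_fun].
Qed.

Definition pullback (f : 'C[R](X)) : 'C[R](Y) := mkcts (@pullback_cont f).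

Fact pullback_linear : linear pullback.
Proof. by move=> a f g; apply: contfunP. Qed.

HB.instance Definition _ :=
  GRing.isLinear.Build R[i] 'C[R](X) 'C[R](Y) *:%R pullback pullback_linear.

Lemma pullback_star_hom : star_hom pullback.
Proof. by split=> [f g|f]; apply: contfunP. Qed.

End Pullback.

(** * Bounds and a distance adapted to finitely many functions *)

Section Bounds.
Variables (R : realType) (X : topologicalType).

Lemma mdist_continuous (M : metricType R) (e : X -> M) a :
  continuous e -> continuous (fun x => mdist (e x) a).
Proof.
move=> ce x; apply/cvgrPdist_lt => d d0.
have := ce x _ (nbhsx_ballx (e x) _ d0); apply: (@filterS _ (nbhs x)) => y.
rewrite /= ballEmdist/= => xy; apply: le_lt_trans xy.
have := metric_triangle (e x) (e y) a; have := metric_triangle (e y) (e x) a.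
by rewrite (metric_sym (e y) (e x)) ler_norml; lra.
Qed.

Lemma compact_bound (s : seq 'C[R](X)) : compact [set: X] ->
  exists M, forall f, f \in s -> forall x, complex.Re `|f x| <= M.
Proof.
move=> Xc; pose g x := \sum_(f <- s) complex.Re `|f x|.
have cg : continuous g.
  apply: (@continuous_sum R X _ s (fun (f : 'C[R](X)) x => complex.Re `|f x|)).
  move=> f; apply: (continuous_Re (F := fun x => `|f x|)) => x.
  by apply: cvg_norm; exact: cts_fun.
have : compact (range g).
  by apply: continuous_compact => //; exact: continuous_subspaceT.
move=> /(@compact_bounded R R^o) [M [_ /(_ (M + 1))]].
rewrite ltrDl ltr01 => /(_ isT) gM; exists (M + 1) => f sf x.
apply: le_trans (gM (g x) _); last by exists x.
apply: le_trans (ler_norm _); rewrite /g (big_rem f)//= lerDl.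
by apply: sumr_ge0 => h _; exact: Re_norm_ge0.
Qed.

(** Adding the oscillation of the functions to the metric makes a small radius
    control both the points and the values. *)
Lemma adapted_distance (s : seq 'C[R](X)) : metrizable R X ->
  exists D : X -> X -> R,
    [/\ forall x a, 0 <= D x a, forall x, D x x = 0,
        forall x a, D x a = 0 -> x = a, forall a, continuous (D^~ a) &
        forall f, f \in s -> forall x a, complex.Re `|f x - f a| <= D x a].
Proof.
move=> [M [e [e' [ce _ ee' _]]]].
have osc_ge0 (r : seq 'C[R](X)) x a :
    0 <= \sum_(f <- r) complex.Re `|f x - f a|.
  by apply: sumr_ge0 => f _; exact: Re_norm_ge0.
exists (fun x a => mdist (e x) (e a) + \sum_(f <- s) complex.Re `|f x - f a|).
split=> [x a|x|x a|a x|f sf x a].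
- by rewrite addr_ge0 ?mdist_ge0.
- by rewrite mdistxx add0r big1_seq// => f _; rewrite subrr normr0.
- move=> /eqP; rewrite paddr_eq0 ?mdist_ge0// => /andP[/eqP xa _].
  by apply: (can_inj ee'); exact: mdist_positivity xa.
- apply: cvgD; first exact: mdist_continuous.
  apply: (@continuous_sum R X _ s
    (fun (f : 'C[R](X)) x => complex.Re `|f x - f a|)) => f.
  exact: continuous_dist_fun.
- rewrite (big_rem f)//= addrCA lerDl addr_ge0 ?mdist_ge0//.
  exact: osc_ge0.
Qed.

End Bounds.

(** * Unital positive maps *)

Section PositiveMaps.
Local Open Scope complex_scope.
Variables (R : realType) (X Y : topologicalType).
Variable phi : {linear 'C[R](X) -> 'C[R](Y)}.
Hypotheses (phi1 : unital phi) (phi_ge0 : positive phi).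

Lemma phi_const (c : R[i]) y : phi (c *: (1 : 'C[R](X))) y = c.
Proof. by rewrite linearZ/= phi1; exact: mulr1. Qed.

(** [t - u] is nonnegative, hence so is its image, and a nonnegative complex
    number is real. *)
Lemma phi_realfun_le (u : X -> R) (cu : continuous u) t y :
  (forall x, u x <= t) ->
  phi (realfun cu) y = (complex.Re (phi (realfun cu) y))%:C /\
  complex.Re (phi (realfun cu) y) <= t.
Proof.
move=> ut; have : nonneg (t%:C *: (1 : 'C[R](X)) - realfun cu).
  move=> x; change (0 <= t%:C * 1 - (u x)%:C).
  by rewrite mulr1 subr_ge0 lecR.
move=> /phi_ge0/(_ y); rewrite linearB.
change (0 <= phi (t%:C *: (1 : 'C[R](X))) y - phi (realfun cu) y ->
  phi (realfun cu) y = (complex.Re (phi (realfun cu) y))%:C /\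
  complex.Re (phi (realfun cu) y) <= t).
rewrite phi_const subr_ge0 lecE/= => /andP[/eqP im re]; split=> //.
by apply/eqP; rewrite eq_complex/= eqxx eq_sym im eqxx.
Qed.

(** The image of the imaginary part of [f] is real, so it does not contribute to
    the real part of [phi f]. *)
Lemma Re_phi_le (f : 'C[R](X)) t y :
  (forall x, complex.Re `|f x| <= t) -> complex.Re (phi f y) <= t.
Proof.
move=> ft; have Re_le (g : 'C[R](X)) : (forall x, complex.Re `|g x| <= t) ->
    forall x, complex.Re (g x) <= t.
  by move=> gt x; apply: le_trans (ler_norm _) (le_trans (normRe_le _) (gt x)).
have ift x : complex.Re `|(- 'i%C *: f) x| <= t.
  change (complex.Re `|- 'i%C * f x| <= t).
  by rewrite normrM normrN normi mul1r.
rewrite [f]cartesian linearD linearZ.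
set a := realfun _; set b := realfun _.
change (complex.Re (phi a y + 'i%C * phi b y) <= t).
have [_ at_] := phi_realfun_le (@continuous_Re_fun _ _ f) y (Re_le f ft).
have [-> _] := phi_realfun_le (@continuous_Re_fun _ _ (- 'i%C *: f)) y (Re_le _ ift).
by rewrite ReD /= mul0r mul1r subrr addr0.
Qed.

Lemma phi_realfun_ge0 (u : X -> R) (cu : continuous u) y :
  (forall x, 0 <= u x) -> 0 <= complex.Re (phi (realfun cu) y).
Proof.
move=> u0; have : nonneg (realfun cu) by move=> x; rewrite ler0c.
by move=> /phi_ge0/(_ y); rewrite lecE => /andP[].
Qed.

Lemma phi_partition n (rho : nat -> X -> R) (crho : forall k, continuous (rho k))
    y :
  (forall x, \sum_(k < n.+1) rho k x = 1) ->
  \sum_(k < n.+1) complex.Re (phi (realfun (crho k)) y) = 1.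
Proof.
move=> rho1.
rewrite -Re_sum -(cf_sumE _ (fun k : 'I_n.+1 => phi (realfun (crho k)))).
rewrite -linear_sum/=.
have -> : \sum_(k < n.+1) realfun (crho k) = 1; last by rewrite phi1.
apply: contfunP => x; rewrite [LHS]cf_sumE.
transitivity ((\sum_(k < n.+1) rho k x)%:C); first by rewrite rmorph_sum.
by rewrite rho1.
Qed.

(** The difference [f - sum_k f (pt k) rho_k] is [sum_k rho_k (f - f (pt k))],
    which is bounded by [delta] because each term lives where [f] is close to
    [f (pt k)]; a unital positive map does not increase that bound. *)
Lemma phi_quantize n (rho : nat -> X -> R)
    (crho : forall k, continuous (rho k)) (pt : nat -> X) (f : 'C[R](X)) delta y :
  (forall k x, 0 <= rho k x) -> (forall x, \sum_(k < n.+1) rho k x = 1) ->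
  (forall k x, rho k x != 0 -> complex.Re `|f x - f (pt k)| <= delta) ->
  complex.Re (phi f y) -
    \sum_(k < n.+1) complex.Re (phi (realfun (crho k)) y) *
      complex.Re (f (pt k)) <= delta.
Proof.
move=> rho0 rho1 osc.
pose r : 'C[R](X) := f - \sum_(k < n.+1) f (pt k) *: realfun (crho k).
have -> : complex.Re (phi f y) -
    \sum_(k < n.+1) complex.Re (phi (realfun (crho k)) y) *
      complex.Re (f (pt k)) = complex.Re (phi r y).
  pose s := \sum_(k < n.+1) phi (f (pt k) *: realfun (crho k)).
  have -> : phi r = phi f - s by rewrite /r linearB linear_sum.
  rewrite -[RHS]/(complex.Re (phi f y - s y)).
  rewrite ReB /s cf_sumE Re_sum; congr (_ - _); apply: eq_bigr => k _.
  rewrite linearZ.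
  rewrite -[RHS]/(complex.Re (f (pt k) * phi (realfun (crho k)) y)).
  have rle1 x : rho k x <= 1 by rewrite -(rho1 x) (bigD1 k)//= lerDl sumr_ge0.
  have [-> _] := phi_realfun_le (crho k) y rle1.
  by rewrite [in RHS]mulrC Re_mul_real.
apply: Re_phi_le => x.
have -> : r x = \sum_(k < n.+1) (rho k x)%:C * (f x - f (pt k)).
  rewrite /r; set s := \sum_(k < _) _.
  change (f x - s x = \sum_(k < n.+1) (rho k x)%:C * (f x - f (pt k))).
  under eq_bigr do rewrite mulrBr.
  rewrite sumrB -mulr_suml -rmorph_sum rho1 mul1r /s cf_sumE; congr (_ - _).
  by apply: eq_bigr => k _; exact: mulrC.
rewrite -[leRHS]mul1r -(rho1 x) mulr_suml -lecR Re_norm rmorph_sum/=.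
apply: (le_trans (ler_norm_sum _ _ _)); apply: ler_sum => k _.
have -> : `|(rho k x)%:C * (f x - f (pt k))| =
    (rho k x * complex.Re `|f x - f (pt k)|)%:C.
  by rewrite rmorphM/= Re_norm normrM normc_real (ger0_norm (rho0 k x)).
rewrite lecR.
have [->|r0] := eqVneq (rho k x) 0; first by rewrite !mul0r.
by rewrite ler_wpM2l// osc.
Qed.

Variables (p q : X) (z w : Y) (alpha : R).
Hypotheses (alpha_gt0 : 0 < alpha) (alpha_lt1 : alpha < 1).
Hypothesis phi_twisted :
  forall f, twisted p q alpha f -> twisted z w alpha (phi f).

(** Two functionals, of which the first vanishes on the kernel of the second, are
    proportional; they agree at [1], where both equal [1 - alpha], which is not
    zero. *)
Lemma twisted_defect (f : 'C[R](X)) :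
  phi f z - alpha%:C * phi f w = f p - alpha%:C * f q.
Proof.
pose c := (f p - alpha%:C * f q) / (1 - alpha%:C).
have a1 : 1 - alpha%:C != 0.
  by rewrite subr_eq0 eq_sym lt_eqF// (ltcR alpha 1).
have ce : f p - alpha%:C * f q = c * (1 - alpha%:C) by rewrite mulfVK.
have shift (a b k d : R[i]) : a - k * b = d * (1 - k) <-> a - d = k * (b - d).
  by split=> /eqP; rewrite -subr_eq0 => /eqP e; apply/eqP;
    rewrite -subr_eq0 -e; apply/eqP; ring.
have : twisted p q alpha (f - c *: (1 : 'C[R](X))).
  change (f p - c * 1 = alpha%:C * (f q - c * 1)).
  by rewrite mulr1; apply/shift.
move=> /phi_twisted; rewrite /twisted/= linearB.
change (phi f z - phi (c *: (1 : 'C[R](X))) z =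
    alpha%:C * (phi f w - phi (c *: (1 : 'C[R](X))) w) ->
  phi f z - alpha%:C * phi f w = f p - alpha%:C * f q).
by rewrite !phi_const ce => /shift.
Qed.

(** Here [twisted_defect] reads [phi u z = 1 + alpha * phi u w], which is at
    least [1]: the measure at [z] is the Dirac mass at [p]. *)
Lemma phi_peak_left (u : X -> R) (cu : continuous u) :
  (forall x, 0 <= u x <= 1) -> u p = 1 -> u q = 0 ->
  complex.Re (phi (realfun cu) z) = 1.
Proof.
move=> u01 up uq.
have u_le1 x : u x <= 1 by case/andP: (u01 x).
have u_ge0 x : 0 <= u x by case/andP: (u01 x).
have [_ le1] := phi_realfun_le cu z u_le1.
have ge0 := phi_realfun_ge0 cu w u_ge0.
have := twisted_defect (realfun cu).
change (realfun cu p) with (u p)%:C; change (realfun cu q) with (u q)%:C.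
rewrite up uq mulr0 subr0 => /(congr1 (@complex.Re R)).
rewrite ReB Re_mul_real/= => e.
have : 0 <= alpha * complex.Re (phi (realfun cu) w) by rewrite mulr_ge0// ltW.
lra.
Qed.

(** Here [twisted_defect] reads [alpha * phi u w = alpha + phi u z], so that
    [phi u w] is at least [1]: the measure at [w] is the Dirac mass at [q]. *)
Lemma phi_peak_right (u : X -> R) (cu : continuous u) :
  (forall x, 0 <= u x <= 1) -> u p = 0 -> u q = 1 ->
  complex.Re (phi (realfun cu) w) = 1.
Proof.
move=> u01 up uq.
have u_le1 x : u x <= 1 by case/andP: (u01 x).
have u_ge0 x : 0 <= u x by case/andP: (u01 x).
have [_ le1] := phi_realfun_le cu w u_le1.
have ge0 := phi_realfun_ge0 cu z u_ge0.
have := twisted_defect (realfun cu).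
change (realfun cu p) with (u p)%:C; change (realfun cu q) with (u q)%:C.
rewrite up uq mulr1 sub0r => /(congr1 (@complex.Re R)).
rewrite ReB Re_mul_real -rmorphN/= => e.
apply/eqP; rewrite eq_le le1/= -(ler_pM2l alpha_gt0); lra.
Qed.

End PositiveMaps.

(** * Approximation by averages of homomorphisms *)

Theorem theorem1p3 (R : realType) (X Y : topologicalType)
    (Xcompact : compact [set: X]) (Xmetrizable : metrizable R X)
    (Xpath : path_connected R X)
    (Ycompact : compact [set: Y]) (Ymetrizable : metrizable R Y)
    (p q : X) (pq : p <> q) (z w : Y)
    (alpha : R) (alpha_gt0 : 0 < alpha) (alpha_lt1 : alpha < 1)
    (F : set 'C[R](X)) (Ffinite : finite_set F)
    (Fsub : F `<=` twisted p q alpha)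
    (eps : R) (eps_gt0 : 0 < eps) :
  exists2 N : nat, (0 < N)%N &
    forall phi : {linear 'C[R](X) -> 'C[R](Y)},
      unital phi -> positive phi ->
      (forall f, twisted p q alpha f -> twisted z w alpha (phi f)) ->
      exists phi_ : 'I_N -> {linear 'C[R](X) -> 'C[R](Y)},
        [/\ forall i, star_hom (phi_ i),
            forall f, twisted p q alpha f ->
              twisted z w alpha (N%:R^-1 *: \sum_(i < N) phi_ i f) &
            forall f, F f ->
              supnorm (phi f - N%:R^-1 *: \sum_(i < N) phi_ i f) < eps].
Proof.
have [s Fs] := (finite_seqP F).1 Ffinite.
have [M fM] := compact_bound s Xcompact.
have [D [D0 Dxx Deq cD DF]] := adapted_distance s Xmetrizable.
have eps2 : 0 < eps / 2 by rewrite divr_gt0.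
have [n [pt [rho [[pt0 ptn] [rho0p rho0q rhonp rhonq] crho [rho0 rho1] rhoD]]]] :=
  pinned_partition Xcompact D0 Dxx Deq cD pq eps2.
have rho01 k x : (k < n.+1)%N -> 0 <= rho k x <= 1.
  move=> kn; rewrite rho0 -(rho1 x) (bigD1 (Ordinal kn))//= lerDl.
  exact: sumr_ge0.
(* The two halves of [eps] pay for the partition and for the quantiles. *)
pose N := (Num.truncn (2 * M * n%:R / (eps / 2))).+1.
have Nbig : 2 * M * n%:R / N%:R < eps / 2.
  rewrite ltr_pdivrMr ?ltr0n// [ltRHS]mulrC -ltr_pdivrMr//.
  exact: truncnS_gt.
exists N => // phi phi1 phi_ge0 phiT.
pose l k y := complex.Re (phi (realfun (crho k)) y).
have cl k : continuous (l k) by exact: continuous_Re_fun.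
have l0 k y : 0 <= l k y by exact: phi_realfun_ge0.
have l1 y : \sum_(k < n.+1) l k y = 1 by exact: phi_partition.
have lz : l 0%N z = 1.
  apply: (phi_peak_left phi1 phi_ge0 alpha_gt0 alpha_lt1 phiT) => // x.
  exact: rho01.
have lw : l n w = 1.
  apply: (phi_peak_right phi1 phi_ge0 alpha_gt0 alpha_lt1 phiT) => // x.
  exact: rho01.
have [h [ch hzw hM]] :=
  maps_along_path pt Xpath (ltn0Sn _ : (0 < N)%N) cl l0 l1 lz lw.
have avgE f y : (N%:R^-1 *: \sum_(i < N) pullback (ch i) f) y =
    N%:R^-1 * \sum_(i < N) f (h i y).
  by congr (_ * _); exact: cf_sumE.
exists (fun i => pullback (ch i)); split.
- by move=> i; exact: pullback_star_hom.
- have avg_const (c : R[i]) : N%:R^-1 * \sum_(i < N) c = c.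
    by rewrite sumr_const card_ord -[X in _ * X]mulr_natl mulKf// pnatr_eq0.
  move=> f fT; rewrite /twisted/= !avgE.
  rewrite (eq_bigr (fun=> f p)) => [|i _]; last by rewrite (hzw i).1 pt0.
  rewrite [in RHS](eq_bigr (fun=> f q)) => [|i _]; last by rewrite (hzw i).2 ptn.
  by rewrite !avg_const; exact: fT.
move=> f; rewrite Fs/= => sf.
apply: (@le_lt_trans _ _ (eps / 2 + 2 * M * n%:R / N%:R)); last by lra.
pose avg := N%:R^-1 *: \sum_(i < N) pullback (ch i) f.
apply: ge_sup; first by exists (complex.Re `|(phi f - avg) z|), z.
move=> _ [y _ <-]; apply: norm_le_phase => u u1.
pose g := u *: f.
have gE x : g x = u * f x by [].
have -> : complex.Re (u * (phi f - avg) y) =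
    complex.Re (phi g y) - N%:R^-1 * \sum_(i < N) complex.Re (g (h i y)).
  change (complex.Re (u * (phi f y - avg y)) =
    complex.Re (phi g y) - N%:R^-1 * \sum_(i < N) complex.Re (g (h i y))).
  have -> : phi g = u *: phi f by rewrite /g linearZ.
  rewrite /avg avgE [LHS]Re_mulB; congr (_ - _).
  exact: Re_average.
have gM x : `|complex.Re (g x)| <= M.
  by apply: le_trans (normRe_le _) _; rewrite gE normrM u1 mul1r fM.
have gosc k x : rho k x != 0 -> complex.Re `|g x - g (pt k)| <= eps / 2.
  move=> /rhoD/ltW; apply: le_trans.
  by rewrite !gE norm_phase_dist// DF.
have := phi_quantize phi1 phi_ge0 crho y rho0 rho1 gosc.
have := hM (fun x => complex.Re (g x)) M gM y.
by rewrite ler_norml /l => /andP[_]; lra.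
Qed.
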